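(* For every infinite set $V$ of variables, $\mathbf L_{FOL}(V)=\langle\mathcal{FOL}_t(V):P_t(V)\in\mathrm{Sig}(V)\rangle$ is a logic family.
   Context: First-order logic $\mathcal{FOL}_t(V)$ for a nonempty relational similarity type $t$ (arities $\ge1$) and variable set $V$: atomic formulas $P_t(V)=\{r(v_1,\dots,v_n):r\in\mathrm{dom}(t),t(r)=n,v_i\in V\}$; connectives binary $\wedge$, unary $\neg$ and $\exists v$ ($v\in V$), constants $\bot$ and $v=w$ ($v,w\in V$); models are $t$-structures $\mathfrak M$ with universe $M$; $\mathrm{mng}_{\mathfrak M}(\phi)=\{h\in{}^VM:\mathfrak M\models\phi[h]\}$; $\mathfrak M\models\phi$ iff $\phi$ holds under all assignments. $\mathrm{Sig}(V)=\{P_t(V): t$ a nonempty relational similarity type$\}$ (each $P_t(V)$ determines $t$). General notions: a logic $\langle F,M,\mathrm{mng},\models\rangle$ has formula algebra $\mathfrak F$ (term algebra over atomic formulas in the connectives), models, validity, and meaning homomorphisms $\mathrm{mng}_{\mathfrak M}$; tautological congruence $\sim=\bigcap_{\mathfrak M}\ker(\mathrm{mng}_{\mathfrak M})$; $\mathrm{Alg}_m(\mathcal L)=\{\mathrm{mng}_{\mathfrak M}(\mathfrak F)\}$. A logic family is $\mathbf L=\langle\mathcal L^P:P\in\mathrm{Sig}\rangle$ with: (1) $P$ is the set of atomic formulas of $\mathcal L^P$; (2) common connectives; (3) $P\subseteq Q$ implies $\mathcal L^P$ is a reduct of $\mathcal L^Q$ (i.e. $\mathfrak F^P\le\mathfrak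 F^Q$ and there is a surjection $M^Q\to M^P$ preserving meanings and validity of formulas in $F^P$); (4) whenever $P\in\mathrm{Sig}$ is the disjoint union of $P_i\in\mathrm{Sig}$ ($i\in I$), $\sim^P=\bigcap\{\ker h: h$ a homomorphism from $\mathfrak F^P$ into a member of $\mathrm{Alg}_m(\mathcal L^P)$ with $\bigcup_i\sim^{P_i}\subseteq\ker h\}$; (5a) for $P\in\mathrm{Sig}$ and any set $H$ there is $P'\in\mathrm{Sig}$ disjoint from $H$ with $\mathcal L^{P'}$ an isomorphic copy of $\mathcal L^P$ (isomorphism = formula-algebra isomorphism plus bijection of models preserving meanings and validity); (5b) for any nonempty family $P_i\in\mathrm{Sig}$ there are pairwise disjoint $P_i'\in\mathrm{Sig}$ with $\mathcal L^{P_i'}$ isomorphic copies of $\mathcal L^{P_i}$ and $\bigcup P_i'\in\mathrm{Sig}$; (5c) $\mathrm{Sig}$ has a nonempty member. *)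

(* Defs.v *)
From Stdlib Require Import List FinFun ClassicalEpsilon ProofIrrelevance FunctionalExtensionality.
From Stdlib Require Fin.

Set Implicit Arguments.
Unset Strict Implicit.

(** Types in [SmallType] play the role of sets; types that need not live in
    [SmallType] play the role of classes.  A predicate on a class is a set when
    it is the range of a function defined on a small type. *)
Definition SmallType := Type.

Definition small {T : Type} (P : T -> Prop) : Prop :=
  exists (A : SmallType) (f : A -> T), forall x, P x <-> exists a, f a = x.

Definition subset {T : Type} (P Q : T -> Prop) : Prop := forall x, P x -> Q x.

Definition disjoint {T : Type} (P Q : T -> Prop) : Prop :=
  forall x, ~ (P x /\ Q x).

Definition pairwise_disjoint {I T : Type} (P : I -> T -> Prop) : Prop :=
  forall i j, i <> j -> disjoint (P i) (P j).

Definition union {I T : Type} (P : I -> T -> Prop) : T -> Prop :=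
  fun x => exists i, P i x.

Lemma subset_union {I T : Type} (P : I -> T -> Prop) (i : I) :
  subset (P i) (union P).
Proof. intros x Hx; exists i; exact Hx. Qed.

Arguments subset_union {I T} P i.

(** * Algebras *)

Record connectives := {
  connective :> Type;
  rank : connective -> nat
}.

Record algebra (C : connectives) := {
  carrier :> Type;
  op : forall c : C, (Fin.t (rank c) -> carrier) -> carrier
}.

Definition is_hom (C : connectives) (A B : algebra C) (f : A -> B) : Prop :=
  forall (c : C) (xs : Fin.t (rank c) -> A),
    f (op xs) = op (fun i => f (xs i)).

(** The kernel of [f] is a congruence of [A]. *)
Definition compositional (C : connectives) (A : algebra C) (Y : Type)
    (f : A -> Y) : Prop :=
  forall (c : C) (xs ys : Fin.t (rank c) -> A),
    (forall i, f (xs i) = f (ys i)) -> f (op xs) = f (op ys).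

Definition image (X Y : Type) (f : X -> Y) : Type := {y : Y | exists x, f x = y}.

Definition to_image (X Y : Type) (f : X -> Y) (x : X) : image f :=
  exist _ (f x) (ex_intro _ x eq_refl).

Definition preimage (X Y : Type) (f : X -> Y) (y : image f) : X :=
  proj1_sig (constructive_indefinite_description _ (proj2_sig y)).

(** The algebra [f(A)].  When [f] is compositional the choice of preimages is
    immaterial and [f] is a homomorphism onto [image_algebra f]
    (see [to_image_hom]). *)
Definition image_algebra (C : connectives) (A : algebra C) (Y : Type)
    (f : A -> Y) : algebra C :=
  {| carrier := image f;
     op := fun c ys => to_image f (op (fun i => preimage (ys i))) |}.

Lemma preimageK (X Y : Type) (f : X -> Y) (y : image f) :
  f (preimage y) = proj1_sig y.
Proof.
  unfold preimage.
  destruct (constructive_indefinite_description _ _) as [x Hx]; exact Hx.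
Qed.

Lemma to_image_hom (C : connectives) (A : algebra C) (Y : Type) (f : A -> Y) :
  compositional f <-> is_hom (B := image_algebra f) (to_image f).
Proof.
  split.
  - intros Hf c xs; apply subset_eq_compat; apply Hf; intro i.
    symmetry; apply (preimageK (to_image f (xs i))).
  - intros Hf c xs ys E.
    assert (E' : (fun i => to_image f (xs i)) = (fun i => to_image f (ys i))).
    { apply functional_extensionality; intro i; apply subset_eq_compat; apply E. }
    assert (H : to_image f (op xs) = to_image f (op ys)).
    { rewrite (Hf c xs), (Hf c ys), E'; reflexivity. }
    exact (f_equal (@proj1_sig _ _) H).
Qed.

(** * Formula algebras *)

Inductive term (C : connectives) (X : Type) : Type :=
| atom (x : X)
| app (c : C) (ts : Fin.t (rank c) -> term C X).

Arguments atom {C X} x.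
Arguments app {C X} c ts.

Fixpoint over (C : connectives) (X : Type) (P : X -> Prop) (phi : term C X)
    : Prop :=
  match phi with
  | atom x => P x
  | app _ ts => forall i, over P (ts i)
  end.

(** All formulas are terms over one class [X] of potential atoms, so that
    [P ⊆ Q] literally makes the formulas over [P] a subalgebra of those
    over [Q]; [formula_incl] is the inclusion. *)
Definition formula (C : connectives) (X : Type) (P : X -> Prop) : Type :=
  {phi : term C X | over P phi}.

Definition formula_algebra (C : connectives) (X : Type) (P : X -> Prop)
    : algebra C :=
  {| carrier := formula C P;
     op := fun c ts =>
       exist (over P) (app c (fun i => proj1_sig (ts i)))
                      (fun i => proj2_sig (ts i)) |}.

Lemma over_subset (C : connectives) (X : Type) (P Q : X -> Prop)
    (PQ : subset P Q) (phi : term C X) : over P phi -> over Q phi.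
Proof.
  induction phi as [x | c ts IH]; simpl; [apply PQ | intros H i; apply IH, H].
Qed.

Definition formula_incl (C : connectives) (X : Type) (P Q : X -> Prop)
    (PQ : subset P Q) (phi : formula_algebra C P) : formula_algebra C Q :=
  exist (over Q) (proj1_sig phi) (over_subset PQ (proj2_sig phi)).

(** * Logics *)

(** A logic with connectives [C], set of atomic formulas [P] and meanings taken
    from the class [Y]. *)
Record logic (C : connectives) (X Y : Type) (P : X -> Prop) := {
  model : Type;
  mng : model -> formula_algebra C P -> Y;
  valid : model -> formula_algebra C P -> Prop;
  mng_compositional : forall M : model, compositional (mng M)
}.

Definition taut_congr (C : connectives) (X Y : Type) (P : X -> Prop)
    (L : logic C Y P) (phi psi : formula_algebra C P) : Prop :=
  forall M : model L, mng M phi = mng M psi.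

Definition Alg_m (C : connectives) (X Y : Type) (P : X -> Prop)
    (L : logic C Y P) (A : algebra C) : Prop :=
  exists M : model L, A = image_algebra (mng M).

Definition reduct (C : connectives) (X Y : Type) (P Q : X -> Prop)
    (PQ : subset P Q) (LP : logic C Y P) (LQ : logic C Y Q) : Prop :=
  exists g : model LQ -> model LP,
    Surjective g /\
    forall (M : model LQ) (phi : formula_algebra C P),
      mng M (formula_incl PQ phi) = mng (g M) phi /\
      (valid M (formula_incl PQ phi) <-> valid (g M) phi).

Definition isomorphic (C : connectives) (X Y : Type) (P Q : X -> Prop)
    (LP : logic C Y P) (LQ : logic C Y Q) : Prop :=
  exists (f : formula_algebra C P -> formula_algebra C Q)
         (g : model LP -> model LQ),
    is_hom f /\ Bijective f /\ Bijective g /\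
    forall (M : model LP) (phi : formula_algebra C P),
      mng M phi = mng (g M) (f phi) /\
      (valid M phi <-> valid (g M) (f phi)).

(** That [P] is the set of atomic formulas of [L P] and that the connectives
    are common is enforced by the type of [L]. *)
Record logic_family (C : connectives) (X Y : Type) (Sig : (X -> Prop) -> Prop)
    (L : forall P, Sig P -> logic C Y P) : Prop := {
  lf_set : forall P, Sig P -> small P;

  lf_reduct : forall P Q (SP : Sig P) (SQ : Sig Q) (PQ : subset P Q),
    reduct PQ (L P SP) (L Q SQ);

  lf_union : forall (I : SmallType) (Pi : I -> X -> Prop)
      (SPi : forall i, Sig (Pi i)) (SP : Sig (union Pi)),
    pairwise_disjoint Pi ->
    forall phi psi : formula_algebra C (union Pi),
      taut_congr (L (union Pi) SP) phi psi <->
      forall (A : algebra C) (h : formula_algebra C (union Pi) -> A),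
        Alg_m (L (union Pi) SP) A ->
        is_hom h ->
        (forall (i : I) (x y : formula_algebra C (Pi i)),
            taut_congr (L (Pi i) (SPi i)) x y ->
            h (formula_incl (subset_union Pi i) x) =
            h (formula_incl (subset_union Pi i) y)) ->
        h phi = h psi;

  lf_copy : forall P (SP : Sig P) (H : X -> Prop), small H ->
    exists P' (SP' : Sig P'),
      disjoint P' H /\ isomorphic (L P SP) (L P' SP');

  lf_copies : forall (I : SmallType) (Pi : I -> X -> Prop)
      (SPi : forall i, Sig (Pi i)),
    inhabited I ->
    exists (Pi' : I -> X -> Prop) (SPi' : forall i, Sig (Pi' i)),
      pairwise_disjoint Pi' /\
      (forall i, isomorphic (L (Pi i) (SPi i)) (L (Pi' i) (SPi' i))) /\
      Sig (union Pi');

  lf_nonempty : exists P, Sig P /\ exists x, P x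
}.

(** * First-order logic *)

(** Relation symbols: elements of arbitrary sets.  They form a proper class. *)
Definition symbol : Type := {A : SmallType & A}.

(** Nonempty relational similarity types; [arity r = None] means that [r] is
    not in the domain. *)
Record simtype := {
  arity :> symbol -> option nat;
  arity_pos : forall r n, arity r = Some n -> 1 <= n;
  dom_small : small (fun r => arity r <> None);
  dom_nonempty : exists r, arity r <> None
}.

Inductive fol_connective (V : Type) : Type :=
| c_and
| c_not
| c_ex (v : V)
| c_bot
| c_eq (v w : V).

Definition fol_rank (V : Type) (c : fol_connective V) : nat :=
  match c with
  | c_and _ => 2
  | c_not _ => 1
  | c_ex _ => 1
  | c_bot _ => 0
  | c_eq _ _ => 0
  end.

Definition fol_connectives (V : Type) : connectives :=
  {| connective := fol_connective V; rank := @fol_rank V |}.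

(** [(r, v1 :: ... :: vn :: nil)] stands for [r(v1, ..., vn)]. *)
Definition fol_atom (V : Type) : Type := (symbol * list V)%type.

Definition P_ (V : Type) (t : simtype) : fol_atom V -> Prop :=
  fun a => t (fst a) = Some (length (snd a)).

Arguments P_ V t a : clear implicits.

(** [rel r] is a set of tuples of the length prescribed by [t]; it is empty
    when [r] is not in the domain of [t], so that a structure carries no
    information about other symbols. *)
Record structure (t : simtype) := {
  universe : SmallType;
  universe_nonempty : inhabited universe;
  rel : symbol -> list universe -> Prop;
  rel_arity : forall r xs, rel r xs -> t r = Some (length xs)
}.

Fixpoint sat (V : Type) (t : simtype) (M : structure t)
    (phi : term (fol_connectives V) (fol_atom V)) (h : V -> universe M) : Prop :=
  match phi with
  | atom a => rel (fst a) (map h (snd a))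
  | app c ts =>
      match c as c0
        return (Fin.t (fol_rank c0) -> term (fol_connectives V) (fol_atom V)) -> Prop
      with
      | c_and _ => fun ts => sat (ts Fin.F1) h /\ sat (ts (Fin.FS Fin.F1)) h
      | c_not _ => fun ts => ~ sat (ts Fin.F1) h
      | c_ex v => fun ts =>
          exists h' : V -> universe M, (forall w, w <> v -> h' w = h w) /\ sat (ts Fin.F1) h'
      | c_bot _ => fun _ => False
      | c_eq v w => fun _ => h v = h w
      end ts
  end.

(** Sets of assignments of [V] into some set. *)
Definition fol_meaning (V : SmallType) : Type :=
  {M : SmallType & (V -> M) -> Prop}.

Definition fol_mng (V : SmallType) (t : simtype) (M : structure t)
    (phi : formula_algebra (fol_connectives V) (P_ V t)) : fol_meaning V :=
  existT _ (universe M) (fun h => sat (proj1_sig phi) h).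

Definition fol_valid (V : SmallType) (t : simtype) (M : structure t)
    (phi : formula_algebra (fol_connectives V) (P_ V t)) : Prop :=
  forall h : V -> universe M, sat (proj1_sig phi) h.

Lemma fol_mng_compositional (V : SmallType) (t : simtype) (M : structure t) :
  compositional (@fol_mng V t M).
Proof.
  intros c xs ys E.
  assert (E' : forall i, (fun h : V -> universe M => sat (proj1_sig (xs i)) h) =
                         (fun h : V -> universe M => sat (proj1_sig (ys i)) h)).
  { intro i; exact (inj_pair2 _ _ _ _ _ (E i)). }
  assert (E'' : forall i (h : V -> universe M),
             sat (proj1_sig (xs i)) h = sat (proj1_sig (ys i)) h).
  { intros i h; exact (f_equal (fun S => S h) (E' i)). }
  unfold fol_mng; f_equal; apply functional_extensionality; intro h.
  clear E E'.
  destruct c; simpl in *; try reflexivity.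
  - now rewrite !E''.
  - now rewrite !E''.
  - f_equal; apply functional_extensionality; intro h'; now rewrite E''.
Qed.

Definition FOL (V : SmallType) (t : simtype)
    : logic (fol_connectives V) (fol_meaning V) (P_ V t) :=
  {| model := structure t;
     mng := @fol_mng V t;
     valid := @fol_valid V t;
     mng_compositional := @fol_mng_compositional V t |}.

Definition FOL_Sig (V : SmallType) (P : fol_atom V -> Prop) : Prop :=
  exists t : simtype, P_ V t = P.

(** [P_ V t] determines [t] when [V] is inhabited, so the similarity type picked
    here is the only possible one (see [FOL_family_P_]). *)
Definition FOL_family (V : SmallType) (P : fol_atom V -> Prop) (SP : FOL_Sig P)
    : logic (fol_connectives V) (fol_meaning V) P :=
  let (t, E) := constructive_indefinite_description _ SP in
  eq_rect (P_ V t) (logic (fol_connectives V) (fol_meaning V)) (FOL V t) P E.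

Arguments FOL_family V P SP : clear implicits.

Lemma P_inj (V : SmallType) (t u : simtype) :
  inhabited V -> P_ V t = P_ V u -> t = u.
Proof.
  intros [v] E.
  assert (K : forall r n, t r = Some n <-> u r = Some n).
  { intros r n.
    assert (H := f_equal (fun P => P (r, repeat v n)) E).
    unfold P_ in H; simpl in H; rewrite repeat_length in H.
    rewrite H; tauto. }
  assert (A : arity t = arity u).
  { apply functional_extensionality; intro r.
    destruct (t r) as [n|] eqn:Et.
    - symmetry; now apply K.
    - destruct (u r) as [n|] eqn:Eu; [|reflexivity].
      apply K in Eu; congruence. }
  destruct t as [a p d e], u as [a' p' d' e']; simpl in A; subst a'.
  now rewrite (proof_irrelevance _ p p'), (proof_irrelevance _ d d'),
    (proof_irrelevance _ e e').
Qed.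

Lemma FOL_family_P_ (V : SmallType) (t : simtype) (S : FOL_Sig (P_ V t)) :
  inhabited V -> FOL_family V (P_ V t) S = FOL V t.
Proof.
  intro iV; unfold FOL_family.
  destruct (constructive_indefinite_description _ S) as [u E].
  assert (U := P_inj iV E); subst u.
  now rewrite (proof_irrelevance _ E eq_refl).
Qed.

(* Main.v *)
From Stdlib Require Import FinFun List ClassicalEpsilon ChoiceFacts.
From Stdlib Require Import ProofIrrelevance FunctionalExtensionality PropExtensionality.
Require Import Defs.
Import ListNotations.

Set Implicit Arguments.
Unset Strict Implicit.

(** For the union condition, a homomorphism [h] from the formulas over the union
    into the meaning algebra of [M] sends each atom [r(v1, ..., vn)] to a set of
    assignments with finite support, since it is the meaning of a formula in [M].
    The tautologies [r(v) <-> exists w, r(v)], for [w] not among the [v], cut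
    this support down to the [v].  The tautologies [r(v) /\ v = u <-> r(u) /\ v = u],
    used with [u] fresh (this is where [V] is infinite), show that all the sets
    [h(r(v))] come from one relation on the universe of [M].  Each of these
    tautologies concerns a single symbol, hence lives in a single summand.  So [h]
    is the meaning function of another structure on the same universe, and it
    identifies tautologically equivalent formulas.

    Disjoint copies are obtained by renaming symbols.  Symbols outside a given set
    exist since, by Cantor's argument, the powerset of the disjoint union of the
    types of its elements embeds in none of these types. *)

(** * Functions and small predicates *)

Lemma predicate_extensionality (T : Type) (P Q : T -> Prop) :
  (forall x, P x <-> Q x) -> P = Q.
Proof.
  intro PQ; apply functional_extensionality; intro x.
  apply propositional_extensionality, PQ.
Qed.

Lemma functional_choice (A B : Type) (R : A -> B -> Prop) :
  (forall x, exists y, R x y) -> exists f : A -> B, forall x, R x (f x).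
Proof.
  exact (constructive_indefinite_descr_fun_choice constructive_indefinite_description R).
Qed.

Lemma partial_function_of_functional_relation (A B : Type) (R : A -> B -> Prop) :
  (forall a b b', R a b -> R a b' -> b = b') ->
  exists f : A -> option B, forall a b, f a = Some b <-> R a b.
Proof.
  intro R_functional.
  apply (@functional_choice _ _ (fun a o => forall b, o = Some b <-> R a b)); intro a.
  destruct (classic (exists b, R a b)) as [[b Rab] | none].
  - exists (Some b); intro b'; split.
    + intro E; injection E as <-; exact Rab.
    + intro Rab'; f_equal; exact (R_functional a b b' Rab Rab').
  - exists None; intro b; split; [discriminate | intro Rab; exfalso; eauto].
Qed.

Definition injective_on (A B : Type) (P : A -> Prop) (f : A -> B) : Prop :=
  forall x y, P x -> P y -> f x = f y -> x = y.

Lemma injective_on_left_inverse (A B : Type) (P : A -> Prop) (f : A -> B) :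
  inhabited A -> injective_on P f -> exists g, forall x, P x -> g (f x) = x.
Proof.
  intros A_inh f_inj; exists (fun y => epsilon A_inh (fun x => P x /\ f x = y)).
  intros x Px.
  destruct (epsilon_spec A_inh (fun x' => P x' /\ f x' = f x)) as [Px' E]; eauto.
Qed.

Lemma cantor (S : Type) (k : (S -> Prop) -> S) : ~ Injective k.
Proof.
  intro k_inj.
  pose (D := fun x => exists X, k X = x /\ ~ X x).
  assert (not_D : ~ D (k D)).
  { intros [X [E nX]]; apply nX; rewrite (k_inj _ _ E); now exists X. }
  apply not_D; now exists D.
Qed.

Lemma cantor_sigma (A : Type) (T : A -> Type) (a : A)
    (f : ({a : A & T a} -> Prop) -> T a) : ~ Injective f.
Proof.
  intro f_inj; apply (@cantor {a : A & T a} (fun X => existT T a (f X))).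
  intros X Y E; now apply f_inj, inj_pair2 with (P := T).
Qed.

Lemma small_subset (T : Type) (P Q : T -> Prop) : small Q -> subset P Q -> small P.
Proof.
  intros [A [f f_range]] PQ; exists {a : A | P (f a)}, (fun a => f (proj1_sig a)).
  intro x; split.
  - intro Px; destruct (proj1 (f_range x) (PQ x Px)) as [a <-].
    now exists (exist (fun a => P (f a)) a Px).
  - intros [[a Pa] <-]; exact Pa.
Qed.

Lemma small_image (T U : Type) (f : T -> U) (P : T -> Prop) :
  small P -> small (fun y => exists x, P x /\ f x = y).
Proof.
  intros [A [g g_range]]; exists A, (fun a => f (g a)); intro y; split.
  - intros [x [Px <-]]; apply g_range in Px as [a <-]; now exists a.
  - intros [a <-]; exists (g a); split; [apply g_range; now exists a | reflexivity].
Qed.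

Lemma small_union (T : Type) (I : SmallType) (P : I -> T -> Prop) :
  (forall i, small (P i)) -> small (union P).
Proof.
  intro P_small.
  destruct (@functional_choice _ _
    (fun i (D : {A : SmallType & A -> T}) => forall x, P i x <-> exists a, projT2 D a = x))
    as [D D_range].
  { intro i; destruct (P_small i) as [A [f f_range]].
    now exists (existT (fun A : SmallType => A -> T) A f). }
  exists {i : I & projT1 (D i)}, (fun p => projT2 (D (projT1 p)) (projT2 p)).
  intro x; split.
  - intros [i Px]; apply D_range in Px as [a <-].
    now exists (existT (fun i => projT1 (D i)) i a).
  - intros [[i a] <-]; exists i; apply D_range; now exists a.
Qed.

Lemma small_injective_on (T : Type) (P : T -> Prop) :
  small P -> exists (A : SmallType) (c : T -> A), injective_on P c.
Proof.
  intros [A [f f_range]]; exists (option A).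
  destruct (@functional_choice _ _ (fun x o => P x -> option_map f o = Some x)) as [c c_code].
  { intro x; destruct (classic (P x)) as [Px | nPx].
    - apply f_range in Px as [a <-]; now exists (Some a).
    - now exists None. }
  exists c; intros x y Px Py E.
  assert (E' := c_code x Px); rewrite E, (c_code y Py) in E'; congruence.
Qed.

(** * Assignments and supports *)

Lemma map_eq_length (A B : Type) (f g : A -> B) (l m : list A) :
  map f l = map g m -> length l = length m.
Proof. intro E; apply (f_equal (@length B)) in E; now rewrite !length_map in E. Qed.

Section Assignments.

Variables (V U : Type).
Implicit Types (k : V -> U) (S : (V -> U) -> Prop).

Definition update k (v : V) (x : U) : V -> U :=
  fun w => if excluded_middle_informative (w = v) then x else k w.

Lemma update_same k v x : update k v x v = x.
Proof. unfold update; destruct (excluded_middle_informative _); congruence. Qed.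

Lemma update_other k v x w : w <> v -> update k v x w = k w.
Proof. unfold update; destruct (excluded_middle_informative _); congruence. Qed.

Lemma map_update_notin k v x l : ~ In v l -> map (update k v x) l = map k l.
Proof.
  intro v_l; apply map_ext_in; intros w w_l; apply update_other.
  intros ->; contradiction.
Qed.

Lemma assignment_extension k (l us : list V) (xs : list U) :
  NoDup us -> (forall u, In u us -> ~ In u l) -> length us = length xs ->
  exists k', map k' us = xs /\ map k' l = map k l.
Proof.
  revert xs; induction us as [|u us IH]; intros [|x xs] nodup us_l len; try discriminate.
  - now exists k.
  - apply NoDup_cons_iff in nodup as [u_us nodup].
    destruct (IH xs) as [k' [k'_us k'_l]]; auto using in_cons.
    exists (update k' u x); simpl.
    rewrite update_same, !map_update_notin, k'_us; auto using in_eq.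
Qed.

Definition supports (l : list V) S : Prop :=
  forall k k', map k l = map k' l -> S k -> S k'.

Definition finitely_supported S : Prop := exists l, supports l S.

Definition independent_of (v : V) S : Prop :=
  forall k k', (forall w, w <> v -> k w = k' w) -> S k -> S k'.

Lemma supports_incl l m S : incl l m -> supports l S -> supports m S.
Proof.
  intros l_m l_S k k' E; apply l_S, map_ext_in; intros v v_l.
  now apply (proj1 map_ext_in_iff E), l_m.
Qed.

Lemma supports_remove v l S : independent_of v S -> supports (v :: l) S -> supports l S.
Proof.
  intros v_S vl_S k k' E Sk.
  apply (vl_S (update k v (k' v))).
  - apply map_ext_in; intros w w_vl.
    destruct (classic (w = v)) as [-> | wv]; [apply update_same|].
    rewrite update_other by exact wv; apply (proj1 map_ext_in_iff E).
    destruct w_vl; [congruence | assumption].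
  - apply (v_S k); [|exact Sk]; intros w wv; now rewrite update_other.
Qed.

Lemma finitely_supported_supports m S :
  finitely_supported S -> (forall v, ~ In v m -> independent_of v S) -> supports m S.
Proof.
  intros [l l_S] indep.
  assert (lm_S : supports (l ++ m) S).
  { apply supports_incl with l; [apply incl_appl, incl_refl | exact l_S]. }
  clear l_S; induction l as [|v l IH]; [exact lm_S|]; apply IH; simpl in lm_S.
  destruct (classic (In v m)) as [v_m | v_m].
  - apply supports_incl with (v :: l ++ m); [|exact lm_S].
    apply incl_cons; [apply in_or_app; now right | apply incl_refl].
  - exact (supports_remove (indep v v_m) lm_S).
Qed.

End Assignments.

Lemma fresh_variable (V : Type) (l : list V) : ~ Finite V -> exists v, ~ In v l.
Proof. intro V_inf; apply not_all_ex_not; intro l_full; apply V_inf; now exists l. Qed.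

Lemma infinite_inhabited (V : Type) : ~ Finite V -> inhabited V.
Proof. intro V_inf; destruct (fresh_variable [] V_inf) as [v _]; exact (inhabits v). Qed.

Lemma fresh_variables (V : Type) (l : list V) (n : nat) :
  ~ Finite V ->
  exists us, length us = n /\ NoDup us /\ forall u, In u us -> ~ In u l.
Proof.
  intro V_inf; induction n as [|n [us [len [nodup us_l]]]].
  - exists []; repeat split; [constructor | intros u []].
  - destruct (fresh_variable (us ++ l) V_inf) as [u u_fresh].
    rewrite in_app_iff in u_fresh; exists (u :: us); repeat split.
    + simpl; congruence.
    + constructor; tauto.
    + intros w [<- | w_us]; [tauto | now apply us_l].
Qed.

(** * Formula algebras *)

Lemma hom_compose (C : connectives) (A B D : algebra C) (f : A -> B) (g : B -> D) :
  is_hom f -> is_hom g -> is_hom (fun x => g (f x)).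
Proof. intros f_hom g_hom c xs; now rewrite f_hom, g_hom. Qed.

Section Formulas.

Variables (C : connectives) (X : Type).

Definition atomic (P : X -> Prop) (a : X) (Pa : P a) : formula_algebra C P :=
  exist (over P) (atom a) Pa.

Lemma formula_hom_ext (P : X -> Prop) (B : algebra C) (f g : formula_algebra C P -> B) :
  is_hom f -> is_hom g ->
  (forall a (Pa : P a), f (atomic Pa) = g (atomic Pa)) ->
  forall phi, f phi = g phi.
Proof.
  intros f_hom g_hom fg [phi phi_P].
  induction phi as [a | c ts IH]; [apply fg|].
  pose (xs := fun i => exist (over P) (ts i) (phi_P i) : formula_algebra C P).
  change (f (op xs) = g (op xs)).
  rewrite f_hom, g_hom; f_equal; apply functional_extensionality; intro i; apply IH.
Qed.

Lemma formula_incl_hom (P Q : X -> Prop) (PQ : subset P Q) :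
  is_hom (@formula_incl C X P Q PQ).
Proof. intros c xs; now apply subset_eq_compat. Qed.

Lemma formula_incl_atomic (P Q : X -> Prop) (PQ : subset P Q) (a : X) (Pa : P a) (Qa : Q a) :
  formula_incl PQ (atomic Pa) = atomic Qa.
Proof. now apply subset_eq_compat. Qed.

Fixpoint map_atoms (X' : Type) (f : X -> X') (phi : term C X) : term C X' :=
  match phi with
  | atom a => atom (f a)
  | app c ts => app c (fun i => map_atoms f (ts i))
  end.

Lemma over_map_atoms (X' : Type) (P : X -> Prop) (Q : X' -> Prop) (f : X -> X') :
  (forall a, P a -> Q (f a)) -> forall phi, over P phi -> over Q (map_atoms f phi).
Proof. intros PQ phi; induction phi as [a | c ts IH]; simpl; auto. Qed.

Lemma map_atoms_id_on (P : X -> Prop) (f : X -> X) :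
  (forall a, P a -> f a = a) -> forall phi, over P phi -> map_atoms f phi = phi.
Proof.
  intros f_id phi; induction phi as [a | c ts IH]; simpl; intro phi_P; f_equal; auto.
  apply functional_extensionality; auto.
Qed.

End Formulas.

Arguments atomic {C X P a} Pa.

Lemma map_atoms_map_atoms (C : connectives) (X X' X'' : Type) (f : X -> X') (g : X' -> X'')
    (phi : term C X) :
  map_atoms g (map_atoms f phi) = map_atoms (fun a => g (f a)) phi.
Proof.
  induction phi as [a | c ts IH]; simpl; f_equal; now apply functional_extensionality.
Qed.

Definition formula_map (C : connectives) (X X' : Type) (P : X -> Prop) (Q : X' -> Prop)
    (f : X -> X') (PQ : forall a, P a -> Q (f a)) (phi : formula_algebra C P)
    : formula_algebra C Q :=
  exist (over Q) (map_atoms f (proj1_sig phi)) (over_map_atoms PQ (proj2_sig phi)).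

Lemma formula_map_hom (C : connectives) (X X' : Type) (P : X -> Prop) (Q : X' -> Prop)
    (f : X -> X') (PQ : forall a, P a -> Q (f a)) :
  is_hom (formula_map (C := C) PQ).
Proof. intros c xs; now apply subset_eq_compat. Qed.

Lemma formula_map_cancel (C : connectives) (X X' : Type) (P : X -> Prop) (Q : X' -> Prop)
    (f : X -> X') (g : X' -> X)
    (PQ : forall a, P a -> Q (f a)) (QP : forall b, Q b -> P (g b)) :
  (forall a, P a -> g (f a) = a) ->
  forall phi : formula_algebra C P, formula_map QP (formula_map PQ phi) = phi.
Proof.
  intros gf [phi phi_P]; apply subset_eq_compat; simpl.
  rewrite map_atoms_map_atoms; exact (map_atoms_id_on gf phi_P).
Qed.

Lemma taut_congr_of_homs (C : connectives) (X Y : Type) (Q : X -> Prop) (L : logic C Y Q)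
    (I : Type) (Pi : I -> X -> Prop) (Li : forall i, logic C Y (Pi i))
    (PQ : forall i, subset (Pi i) Q) (phi psi : formula_algebra C Q) :
  (forall i, reduct (PQ i) (Li i) L) ->
  (forall (A : algebra C) (h : formula_algebra C Q -> A),
     Alg_m L A -> is_hom h ->
     (forall i (x y : formula_algebra C (Pi i)),
        taut_congr (Li i) x y -> h (formula_incl (PQ i) x) = h (formula_incl (PQ i) y)) ->
     h phi = h psi) ->
  taut_congr L phi psi.
Proof.
  intros reducts homs M.
  assert (E : to_image (mng M) phi = to_image (mng M) psi).
  { apply (homs (image_algebra (mng M))).
    - now exists M.
    - apply to_image_hom, mng_compositional.
    - intros i x y xy; apply subset_eq_compat.
      destruct (reducts i) as [g [_ g_mng]].
      rewrite (proj1 (g_mng M x)), (proj1 (g_mng M y)); apply xy. }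
  exact (f_equal (@proj1_sig _ _) E).
Qed.

(** * The full cylindric set algebra *)

Definition set_algebra (V U : Type) : algebra (fol_connectives V) :=
  {| carrier := (V -> U) -> Prop;
     op := fun c : fol_connectives V =>
       match c as c0 return (Fin.t (fol_rank c0) -> (V -> U) -> Prop) -> (V -> U) -> Prop with
       | c_and _ => fun xs k => xs Fin.F1 k /\ xs (Fin.FS Fin.F1) k
       | c_not _ => fun xs k => ~ xs Fin.F1 k
       | c_ex v => fun xs k => exists k', (forall w, w <> v -> k' w = k w) /\ xs Fin.F1 k'
       | c_bot _ => fun _ _ => False
       | c_eq v w => fun _ k => k v = k w
       end |}.

Lemma sat_hom (V : Type) (P : fol_atom V -> Prop) (t : simtype) (M : structure t) :
  is_hom (A := formula_algebra (fol_connectives V) P) (B := set_algebra V (universe M))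
    (fun phi => @sat V t M (proj1_sig phi)).
Proof. intros [] xs; reflexivity. Qed.

Lemma supports_ex (V U : Type) (v : V) (l : list V) (S : (V -> U) -> Prop) :
  supports l S ->
  supports l (fun k => exists k', (forall w, w <> v -> k' w = k w) /\ S k').
Proof.
  intros l_S k k' E [k1 [k1_k Sk1]]; exists (update k' v (k1 v)); split.
  - intros w wv; now apply update_other.
  - apply (l_S k1); [|exact Sk1]; apply map_ext_in; intros w w_l.
    destruct (classic (w = v)) as [-> | wv]; [now rewrite update_same|].
    rewrite update_other, k1_k by exact wv; exact (proj1 map_ext_in_iff E w w_l).
Qed.

Lemma finitely_supported_op (V U : Type) (c : fol_connectives V)
    (xs : Fin.t (rank c) -> set_algebra V U) :
  (forall i, finitely_supported (xs i)) -> finitely_supported (op xs).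
Proof.
  intro xs_fin; destruct c as [| | v | | v w]; simpl in *.
  - destruct (xs_fin Fin.F1) as [l l_x], (xs_fin (Fin.FS Fin.F1)) as [m m_y].
    exists (l ++ m); intros k k' E [xk yk]; split.
    + refine (supports_incl _ l_x E xk); apply incl_appl, incl_refl.
    + refine (supports_incl _ m_y E yk); apply incl_appr, incl_refl.
  - destruct (xs_fin Fin.F1) as [l l_x]; exists l; intros k k' E nxk xk'.
    now apply nxk, (l_x k').
  - destruct (xs_fin Fin.F1) as [l l_x]; exists l; now apply supports_ex.
  - exists []; intros k k' _ [].
  - exists [v; w]; intros k k' E; simpl in E; congruence.
Qed.

Lemma sat_finitely_supported (V : Type) (t : simtype) (M : structure t)
    (phi : term (fol_connectives V) (fol_atom V)) :
  finitely_supported (@sat V t M phi).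
Proof.
  induction phi as [[r vs] | c ts IH].
  - exists vs; simpl; intros k k' E; now rewrite E.
  - replace (@sat V t M (app c ts)) with (op (fun i => @sat V t M (ts i) : set_algebra V _)).
    + now apply finitely_supported_op.
    + now destruct c.
Qed.

Section FormulaConnectives.

Variables (V : Type) (P : fol_atom V -> Prop).
Notation F := (formula_algebra (fol_connectives V) P).

Definition formula_and (x y : F) : F :=
  @op _ F (c_and V) (fun i => match i with Fin.F1 => x | _ => y end).
Definition formula_ex (v : V) (x : F) : F := @op _ F (c_ex v) (fun _ => x).
Definition formula_eq (v w : V) : F := @op _ F (c_eq v w) (Fin.case0 _).

Fixpoint formula_and_eqs (x : F) (vs ws : list V) : F :=
  match vs, ws with
  | v :: vs, w :: ws => formula_and (formula_eq v w) (formula_and_eqs x vs ws)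
  | _, _ => x
  end.

Variables (U : Type) (h : F -> set_algebra V U).
Hypothesis h_hom : is_hom h.

Lemma hom_and x y k : h (formula_and x y) k <-> h x k /\ h y k.
Proof. unfold formula_and; rewrite h_hom; reflexivity. Qed.

Lemma hom_ex v x k :
  h (formula_ex v x) k <-> exists k', (forall w, w <> v -> k' w = k w) /\ h x k'.
Proof. unfold formula_ex; rewrite h_hom; reflexivity. Qed.

Lemma hom_eq v w k : h (formula_eq v w) k <-> k v = k w.
Proof. unfold formula_eq; rewrite h_hom; reflexivity. Qed.

Lemma hom_and_eqs x vs ws k :
  length vs = length ws ->
  (h (formula_and_eqs x vs ws) k <-> map k vs = map k ws /\ h x k).
Proof.
  revert ws; induction vs as [|v vs IH]; intros [|w ws] len; try discriminate; simpl.
  - tauto.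
  - rewrite hom_and, hom_eq, IH by (now injection len).
    split; [intros [-> [-> xk]] | intros [E xk]; injection E]; auto.
Qed.

End FormulaConnectives.

(** * Homomorphisms respecting first-order equivalence *)

Lemma fol_mng_eq (V : SmallType) (t : simtype) (M : structure t)
    (x y : formula_algebra (fol_connectives V) (P_ V t)) :
  fol_mng M x = fol_mng M y <->
  forall k : V -> universe M, sat (proj1_sig x) k <-> sat (proj1_sig y) k.
Proof.
  split.
  - intros E k; assert (E' := f_equal (fun S => S k) (inj_pair2 _ _ _ _ _ E)).
    simpl in E'; now rewrite E'.
  - intro E; unfold fol_mng; f_equal; now apply predicate_extensionality.
Qed.

Definition uniform_on_atoms (V U : Type) (t : simtype)
    (h : formula_algebra (fol_connectives V) (P_ V t) -> set_algebra V U) : Prop :=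
  forall r vs ws (Pv : P_ V t (r, vs)) (Pw : P_ V t (r, ws)) (k k' : V -> U),
    map k vs = map k' ws -> h (atomic Pv) k -> h (atomic Pw) k'.

Section UniformOnAtoms.

Variables (V : SmallType) (t : simtype).
Notation F := (formula_algebra (fol_connectives V) (P_ V t)).

Lemma taut_congr_ex (a : fol_atom V) (Pa : P_ V t a) (v : V) :
  ~ In v (snd a) -> taut_congr (FOL V t) (atomic Pa) (formula_ex v (atomic Pa)).
Proof.
  intros v_a M; apply fol_mng_eq; intro k; destruct a as [r vs]; simpl; split.
  - intro S; now exists k.
  - intros [k' [k'_k S]]; rewrite <- (map_ext_in k' k vs); [exact S|].
    intros w w_vs; apply k'_k; intros ->; contradiction.
Qed.

Lemma taut_congr_replace_variables (r : symbol) (vs ws : list V)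
    (Pv : P_ V t (r, vs)) (Pw : P_ V t (r, ws)) :
  length vs = length ws ->
  taut_congr (FOL V t) (formula_and_eqs (atomic Pv) vs ws)
                       (formula_and_eqs (atomic Pw) vs ws).
Proof.
  intros len M; apply fol_mng_eq; intro k.
  rewrite !(hom_and_eqs (@sat_hom V (P_ V t) t M) _ _ len); simpl.
  split; intros [E S]; split; auto; congruence.
Qed.

Variables (U : Type) (h : F -> set_algebra V U).
Hypothesis infinite_V : ~ Finite V.
Hypothesis h_hom : is_hom h.
Hypothesis h_fin : forall x, finitely_supported (h x).
Hypothesis h_congr : forall x y, taut_congr (FOL V t) x y -> h x = h y.

Lemma hom_atom_supports (a : fol_atom V) (Pa : P_ V t a) : supports (snd a) (h (atomic Pa)).
Proof.
  apply finitely_supported_supports; [apply h_fin|].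
  intros v v_a k k' E hk; rewrite (h_congr (taut_congr_ex Pa v_a)).
  apply (hom_ex h_hom); now exists k.
Qed.

Lemma hom_atom_replace_variables (r : symbol) (vs ws : list V)
    (Pv : P_ V t (r, vs)) (Pw : P_ V t (r, ws)) (k : V -> U) :
  map k vs = map k ws -> h (atomic Pv) k -> h (atomic Pw) k.
Proof.
  intros E hk.
  assert (len := map_eq_length E).
  apply (hom_and_eqs h_hom (atomic Pw) k len).
  rewrite <- (h_congr (taut_congr_replace_variables Pv Pw len)).
  now apply (hom_and_eqs h_hom).
Qed.

Lemma hom_uniform_on_atoms : uniform_on_atoms h.
Proof.
  intros r vs ws Pv Pw k k' E hk.
  assert (len := map_eq_length E).
  destruct (fresh_variables (vs ++ ws) (length vs) infinite_V)
    as [us [len_us [nodup us_fresh]]].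
  assert (us_vs : forall u, In u us -> ~ In u vs).
  { intros u u_us u_vs; apply (us_fresh u u_us), in_or_app; now left. }
  assert (us_ws : forall u, In u us -> ~ In u ws).
  { intros u u_us u_ws; apply (us_fresh u u_us), in_or_app; now right. }
  assert (Pu : P_ V t (r, us)) by (unfold P_ in *; simpl in *; congruence).
  destruct (@assignment_extension V U k vs us (map k vs)) as [k1 [k1_us k1_vs]];
    [exact nodup | exact us_vs | now rewrite length_map |].
  destruct (@assignment_extension V U k' ws us (map k vs)) as [k2 [k2_us k2_ws]];
    [exact nodup | exact us_ws | now rewrite length_map |].
  apply (@hom_atom_supports _ Pw k2 k' k2_ws).
  apply (@hom_atom_replace_variables r us ws Pu Pw); [congruence|].
  apply (@hom_atom_supports _ Pu k1 k2); [simpl; congruence|].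
  apply (@hom_atom_replace_variables r vs us Pv Pu); [congruence|].
  exact (@hom_atom_supports _ Pv k k1 (eq_sym k1_vs) hk).
Qed.

End UniformOnAtoms.

Section InducedStructure.

Variables (V : Type) (t : simtype) (U : SmallType).
Variable h : formula_algebra (fol_connectives V) (P_ V t) -> set_algebra V U.
Hypothesis inhabited_U : inhabited U.

Definition induced_rel (r : symbol) (xs : list U) : Prop :=
  exists (vs : list V) (Pv : P_ V t (r, vs)) (k : V -> U), map k vs = xs /\ h (atomic Pv) k.

Lemma induced_rel_arity r xs : induced_rel r xs -> t r = Some (length xs).
Proof. intros [vs [Pv [k [<- _]]]]; rewrite length_map; exact Pv. Qed.

Definition induced_structure : structure t :=
  {| universe := U; universe_nonempty := inhabited_U;
     rel := induced_rel; rel_arity := induced_rel_arity |}.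

Lemma sat_induced_structure :
  is_hom h -> uniform_on_atoms h ->
  forall phi, h phi = @sat V t induced_structure (proj1_sig phi).
Proof.
  intros h_hom h_uniform.
  apply formula_hom_ext; [exact h_hom | exact (@sat_hom V (P_ V t) t induced_structure)|].
  intros [r vs] Pv; apply predicate_extensionality; intro k; simpl; split.
  - intro hk; now exists vs, Pv, k.
  - intros [ws [Pw [k' [E hk']]]]; exact (h_uniform _ _ _ _ _ _ _ E hk').
Qed.

End InducedStructure.

(** * Unions of similarity types *)

Section MeaningAlgebra.

Variables (V : SmallType) (t : simtype) (M : structure t).
Notation meaning_algebra := (image_algebra (@fol_mng V t M)).

Definition meaning_set (y : meaning_algebra) : set_algebra V (universe M) :=
  @sat V t M (proj1_sig (preimage y)).

Lemma proj1_meaning_algebra (y : meaning_algebra) :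
  proj1_sig y = existT _ (universe M) (meaning_set y).
Proof. symmetry; exact (preimageK y). Qed.

Lemma meaning_set_hom : is_hom meaning_set.
Proof.
  intros c ys; assert (E := proj1_meaning_algebra (op ys)).
  apply inj_pair2 in E; rewrite <- E.
  exact (@sat_hom V (P_ V t) t M c (fun i => preimage (ys i))).
Qed.

Lemma meaning_set_inj : Injective meaning_set.
Proof.
  intros x y E.
  assert (E' : proj1_sig x = proj1_sig y) by (now rewrite !proj1_meaning_algebra, E).
  destruct x as [x x_im], y as [y y_im]; now apply subset_eq_compat.
Qed.

End MeaningAlgebra.

Section Union.

Variables (V : SmallType) (t : simtype) (I : Type) (ti : I -> simtype).
Hypothesis sub : forall i, subset (P_ V (ti i)) (P_ V t).
Hypothesis cover : subset (P_ V t) (union (fun i => P_ V (ti i))).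
Notation F := (formula_algebra (fol_connectives V) (P_ V t)).

Lemma uniform_on_atoms_cover (U : Type) (h : F -> set_algebra V U) :
  (forall i, uniform_on_atoms (fun x => h (formula_incl (@sub i) x))) ->
  uniform_on_atoms h.
Proof.
  intros h_uniform r vs ws Pv Pw k k' E hk.
  destruct (cover Pv) as [i Qv].
  assert (Qw : P_ V (ti i) (r, ws)).
  { unfold P_ in *; simpl in *; congruence. }
  rewrite <- (formula_incl_atomic _ (@sub i) Qw Pw).
  apply (h_uniform i r vs ws Qv Qw k k' E).
  now rewrite (formula_incl_atomic _ (@sub i) Qv Pv).
Qed.

Lemma set_hom_respects_union (U : SmallType) (h : F -> set_algebra V U) :
  ~ Finite V -> inhabited U -> is_hom h -> (forall x, finitely_supported (h x)) ->
  (forall i x y, taut_congr (FOL V (ti i)) x y ->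
     h (formula_incl (@sub i) x) = h (formula_incl (@sub i) y)) ->
  forall phi psi, taut_congr (FOL V t) phi psi -> h phi = h psi.
Proof.
  intros V_inf U_inh h_hom h_fin h_congr phi psi phi_psi.
  assert (h_uniform : uniform_on_atoms h).
  { apply uniform_on_atoms_cover; intro i.
    apply hom_uniform_on_atoms; auto.
    exact (hom_compose (formula_incl_hom (@sub i)) h_hom). }
  rewrite !(sat_induced_structure U_inh h_hom h_uniform).
  apply predicate_extensionality, (fol_mng_eq (induced_structure h U_inh)), phi_psi.
Qed.

Lemma FOL_union (phi psi : F) (A : algebra (fol_connectives V)) (h : F -> A) :
  ~ Finite V -> Alg_m (FOL V t) A -> is_hom h ->
  (forall i x y, taut_congr (FOL V (ti i)) x y ->
     h (formula_incl (@sub i) x) = h (formula_incl (@sub i) y)) ->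
  taut_congr (FOL V t) phi psi -> h phi = h psi.
Proof.
  intros V_inf [M ->] h_hom h_congr phi_psi; apply meaning_set_inj.
  apply (@set_hom_respects_union (universe M) (fun x => meaning_set (h x))); auto.
  - apply universe_nonempty.
  - exact (hom_compose h_hom (@meaning_set_hom V t M)).
  - intro x; apply sat_finitely_supported.
  - intros i x y xy; f_equal; now apply h_congr.
Qed.

End Union.

(** * Renaming of symbols *)

Definition dom (t : simtype) (r : symbol) : Prop := t r <> None.

Lemma domP (t : simtype) (r : symbol) : dom t r <-> exists n, t r = Some n.
Proof.
  unfold dom; split.
  - destruct (t r) as [n|]; [now exists n | congruence].
  - intros [n ->]; discriminate.
Qed.

Lemma dom_Some (t : simtype) (r : symbol) (n : nat) : t r = Some n -> dom t r.
Proof. intro t_r; apply domP; now exists n. Qed.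

Lemma exists_arity (t : simtype) : exists r n, t r = Some n.
Proof. destruct (dom_nonempty t) as [r r_t]; exists r; now apply domP. Qed.

Lemma P_dom (V : Type) (t : simtype) (a : fol_atom V) : P_ V t a -> dom t (fst a).
Proof. exact (@dom_Some t (fst a) _). Qed.

Definition arity_embedding (t u : simtype) (s s' : symbol -> symbol) : Prop :=
  forall r, dom t r -> u (s r) = t r /\ s' (s r) = r.

Definition rename_atom (V : Type) (s : symbol -> symbol) (a : fol_atom V) : fol_atom V :=
  (s (fst a), snd a).

Lemma P_rename_atom (V : Type) (t u : simtype) (s s' : symbol -> symbol) :
  arity_embedding t u s s' -> forall a, P_ V t a -> P_ V u (rename_atom s a).
Proof.
  intros emb a Pa; unfold P_; simpl.
  rewrite (proj1 (emb _ (P_dom Pa))); exact Pa.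
Qed.

Lemma rename_atom_cancel (V : Type) (t u : simtype) (s s' : symbol -> symbol) :
  arity_embedding t u s s' ->
  forall a, P_ V t a -> rename_atom s' (rename_atom s a) = a.
Proof.
  intros emb [r vs] Pa; unfold rename_atom; simpl.
  now rewrite (proj2 (emb r (P_dom Pa))).
Qed.

(** With [s] the identity this is a reduct or an expansion by empty relations. *)
Definition pullback (t u : simtype) (s : symbol -> symbol) (M : structure t)
    : structure u :=
  {| universe := universe M;
     universe_nonempty := universe_nonempty M;
     rel := fun r xs => @rel t M (s r) xs /\ u r = Some (length xs);
     rel_arity := fun r xs H => proj2 H |}.

Arguments pullback {t} u s M.

Lemma sat_pullback (V : Type) (t u : simtype) (s : symbol -> symbol) (M : structure t)
    (phi : term (fol_connectives V) (fol_atom V)) :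
  over (P_ V u) phi ->
  forall k : V -> universe M,
    @sat V u (pullback u s M) phi k <-> @sat V t M (map_atoms (rename_atom s) phi) k.
Proof.
  induction phi as [[r vs] | c ts IH]; simpl; intros phi_P k.
  - unfold P_ in phi_P; simpl in phi_P; rewrite length_map; tauto.
  - destruct c; simpl in *; try tauto.
    + now rewrite !IH.
    + now rewrite !IH.
    + split; intros [k' [k'_k S]]; exists k'; split; auto; now apply IH.
Qed.

Lemma mng_valid_pullback (V : SmallType) (t u : simtype) (s : symbol -> symbol)
    (M : structure t) (phi : formula_algebra (fol_connectives V) (P_ V u))
    (psi : formula_algebra (fol_connectives V) (P_ V t)) :
  proj1_sig psi = map_atoms (rename_atom s) (proj1_sig phi) ->
  fol_mng M psi = fol_mng (pullback u s M) phi /\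
  (fol_valid M psi <-> fol_valid (pullback u s M) phi).
Proof.
  intro E.
  assert (same_sat : forall k : V -> universe M,
    sat (proj1_sig psi) k <-> @sat V u (pullback u s M) (proj1_sig phi) k).
  { intro k; rewrite E; symmetry; apply sat_pullback, (proj2_sig phi). }
  split.
  - exact (f_equal (existT _ (universe M)) (predicate_extensionality same_sat)).
  - split; intros S k; apply same_sat, S.
Qed.

Lemma structure_ext (t : simtype) (U : SmallType) (ne ne' : inhabited U)
    (R R' : symbol -> list U -> Prop)
    (ar : forall r xs, R r xs -> t r = Some (length xs))
    (ar' : forall r xs, R' r xs -> t r = Some (length xs)) :
  (forall r xs, R r xs <-> R' r xs) ->
  Build_structure ne ar = Build_structure ne' ar'.
Proof.
  intro RR'.
  assert (E : R = R').
  { apply functional_extensionality; intro r; now apply predicate_extensionality. }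
  subst R'; now rewrite (proof_irrelevance _ ne ne'), (proof_irrelevance _ ar ar').
Qed.

Lemma pullback_cancel (t u : simtype) (s s' : symbol -> symbol) (M : structure t) :
  arity_embedding t u s s' -> pullback t s (pullback u s' M) = M.
Proof.
  intro emb; destruct M as [U ne R ar]; apply structure_ext; simpl.
  intros r xs; split.
  - intros [[R_r _] t_r]; now rewrite (proj2 (emb r (dom_Some t_r))) in R_r.
  - intro R_r; assert (t_r := ar r xs R_r).
    destruct (emb r (dom_Some t_r)) as [u_r s'_r]; rewrite s'_r, u_r; auto.
Qed.

Lemma arity_embedding_of_subset (V : Type) (t u : simtype) :
  inhabited V -> subset (P_ V t) (P_ V u) ->
  arity_embedding t u (fun r => r) (fun r => r).
Proof.
  intros [v] tu r r_t; split; [|reflexivity].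
  apply domP in r_t as [n t_r]; rewrite t_r.
  specialize (tu (r, repeat v n)); unfold P_ in tu; simpl in tu.
  rewrite repeat_length in tu; auto.
Qed.

Lemma FOL_reduct (V : SmallType) (t u : simtype) (PQ : subset (P_ V t) (P_ V u)) :
  inhabited V -> reduct PQ (FOL V t) (FOL V u).
Proof.
  intro V_inh; assert (emb := arity_embedding_of_subset V_inh PQ).
  exists (pullback t (fun r => r)); split.
  - intro M; exists (pullback u (fun r => r) M); exact (pullback_cancel M emb).
  - intros M [phi phi_P]; apply mng_valid_pullback; simpl; symmetry.
    apply map_atoms_id_on with (P_ V t); [now intros [r vs] | exact phi_P].
Qed.

Lemma FOL_isomorphic (V : SmallType) (t u : simtype) (s s' : symbol -> symbol) :
  arity_embedding t u s s' -> arity_embedding u t s' s ->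
  isomorphic (FOL V t) (FOL V u).
Proof.
  intros tu ut.
  exists (formula_map (P_rename_atom tu)), (pullback u s').
  split; [|split; [|split]].
  - apply formula_map_hom.
  - exists (formula_map (P_rename_atom ut)); split; apply formula_map_cancel.
    + exact (rename_atom_cancel tu).
    + exact (rename_atom_cancel ut).
  - exists (pullback t s); split; intro M; now apply pullback_cancel.
  - intros M phi; apply mng_valid_pullback.
    assert (E := formula_map_cancel (P_rename_atom tu) (P_rename_atom ut)
                   (rename_atom_cancel tu) phi).
    exact (eq_sym (f_equal (@proj1_sig _ _) E)).
Qed.

(** * Similarity types *)

Lemma simtype_of_relation (R : symbol -> nat -> Prop) :
  (forall r m n, R r m -> R r n -> m = n) -> (forall r n, R r n -> 1 <= n) ->
  small (fun r => exists n, R r n) -> (exists r n, R r n) ->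
  exists t : simtype, forall r n, t r = Some n <-> R r n.
Proof.
  intros R_functional R_pos R_small [r0 [n0 R_r0]].
  destruct (partial_function_of_functional_relation R_functional) as [a a_R].
  unshelve eexists (Build_simtype (arity := a) _ _ _); [| | |exact a_R].
  - intros r n E; now apply (R_pos r), a_R.
  - apply (small_subset R_small); intros r r_a.
    destruct (a r) as [n|] eqn:E; [|congruence]; exists n; now apply a_R.
  - exists r0; apply a_R in R_r0; congruence.
Qed.

Lemma simtype_image (t : simtype) (s : symbol -> symbol) :
  injective_on (dom t) s ->
  exists u : simtype, forall q n, u q = Some n <-> exists r, t r = Some n /\ s r = q.
Proof.
  intro s_inj; apply simtype_of_relation.
  - intros q m n [r [t_r <-]] [r' [t_r' E]].
    rewrite (s_inj r' r (dom_Some t_r') (dom_Some t_r) E) in t_r'; congruence.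
  - intros q n [r [t_r _]]; exact (arity_pos t_r).
  - apply (small_subset (small_image s (dom_small t))).
    intros q [n [r [t_r E]]]; exists r; split; [congruence | exact E].
  - destruct (exists_arity t) as [r [n t_r]]; now exists (s r), n, r.
Qed.

Lemma simtype_union (I : SmallType) (ti : I -> simtype) :
  inhabited I -> (forall i j r m n, ti i r = Some m -> ti j r = Some n -> m = n) ->
  exists u : simtype, forall r n, u r = Some n <-> exists i, ti i r = Some n.
Proof.
  intros [i0] compatible; apply simtype_of_relation.
  - intros r m n [i ti_r] [j tj_r]; exact (compatible i j r m n ti_r tj_r).
  - intros r n [i ti_r]; exact (arity_pos ti_r).
  - apply (small_subset (small_union (fun i => dom_small (ti i)))).
    intros r [n [i ti_r]]; exists i; congruence.
  - destruct (exists_arity (ti i0)) as [r [n t_r]]; now exists r, n, i0.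
Qed.

Lemma simtype_inhabited : inhabited simtype.
Proof.
  pose (unit_symbol := existT (fun A : SmallType => A) unit tt : symbol).
  destruct (@simtype_of_relation (fun r n => r = unit_symbol /\ n = 1)) as [t _].
  - intros r m n [_ ->] [_ ->]; reflexivity.
  - intros r n [_ ->]; constructor.
  - exists unit, (fun _ => unit_symbol); intro r; split.
    + intros [n [-> _]]; now exists tt.
    + intros [_ <-]; now exists 1.
  - now exists unit_symbol, 1.
  - exact (inhabits t).
Qed.

Lemma FOL_renamed (V : SmallType) (t : simtype) (s : symbol -> symbol) :
  injective_on (dom t) s ->
  exists u : simtype, isomorphic (FOL V t) (FOL V u) /\
    forall q, dom u q -> exists r, s r = q.
Proof.
  intro s_inj.
  destruct (simtype_image s_inj) as [u u_image].
  assert (symbol_inh : inhabited symbol).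
  { destruct (dom_nonempty t) as [r _]; exact (inhabits r). }
  destruct (injective_on_left_inverse symbol_inh s_inj) as [s' s's].
  exists u; split.
  - apply FOL_isomorphic with s s'.
    + intros r r_t; split; [|now apply s's].
      apply domP in r_t as [n t_r]; rewrite t_r; apply u_image; now exists r.
    + intros q q_u; apply domP in q_u as [n u_q]; rewrite u_q.
      apply u_image in u_q as [r [t_r <-]].
      rewrite (s's r (dom_Some t_r)); auto.
  - intros q q_u; apply domP in q_u as [n u_q].
    apply u_image in u_q as [r [_ E]]; now exists r.
Qed.

Definition tag (A : SmallType) (a : A) : symbol := existT (fun A : SmallType => A) A a.

Lemma tag_inj (A : SmallType) : Injective (@tag A).
Proof. intros a b E; exact (inj_pair2 _ _ _ _ _ E). Qed.

Lemma FOL_copy (V : SmallType) (t : simtype) (H : fol_atom V -> Prop) :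
  small H ->
  exists u : simtype, disjoint (P_ V u) H /\ isomorphic (FOL V t) (FOL V u).
Proof.
  intros [A [f f_range]].
  destruct (small_injective_on (dom_small t)) as [D [c c_inj]].
  pose (T := fun a : A => projT1 (fst (f a))).
  pose (s := fun r => tag ((fun _ : {a : A & T a} => True), c r)).
  destruct (@FOL_renamed V t s) as [u [iso u_s]].
  { intros r r' r_t r'_t E; apply tag_inj in E; injection E; now apply c_inj. }
  exists u; split; [|exact iso]; intros [q vs] [Pq Hq].
  apply f_range in Hq as [a fa].
  destruct (u_s q (P_dom Pq)) as [r <-].
  assert (Ta : T a = (({a : A & T a} -> Prop) * D)%type) by (unfold T at 1; now rewrite fa).
  assert (embed : exists e : ({a : A & T a} -> Prop) -> T a, Injective e).
  { rewrite Ta; exists (fun X => (X, c r)); intros X Y E; congruence. }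
  destruct embed as [e e_inj]; exact (cantor_sigma e_inj).
Qed.

Lemma P_union (V : Type) (I : Type) (ti : I -> simtype) (u : simtype) :
  (forall r n, u r = Some n <-> exists i, ti i r = Some n) ->
  P_ V u = union (fun i => P_ V (ti i)).
Proof. intro u_union; apply predicate_extensionality; intros [r vs]; apply u_union. Qed.

Lemma FOL_disjoint_copies (V : SmallType) (I : SmallType) (ti : I -> simtype) :
  exists ui : I -> simtype,
    pairwise_disjoint (fun i => dom (ui i)) /\
    forall i, isomorphic (FOL V (ti i)) (FOL V (ui i)).
Proof.
  destruct (small_injective_on (small_union (fun i => dom_small (ti i)))) as [D [c c_inj]].
  pose (s := fun (i : I) (r : symbol) => tag (i, c r)).
  destruct (@functional_choice _ _ (fun i u =>
    isomorphic (FOL V (ti i)) (FOL V u) /\ forall q, dom u q -> exists r, s i r = q))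
    as [ui ui_copy].
  { intro i; apply FOL_renamed; intros r r' r_t r'_t E.
    apply tag_inj in E; injection E; apply c_inj; now exists i. }
  exists ui; split; [|intro i; apply ui_copy].
  intros i j ij q [q_i q_j].
  destruct (proj2 (ui_copy j) q q_j) as [r' <-], (proj2 (ui_copy i) _ q_i) as [r E].
  apply tag_inj in E; congruence.
Qed.

Lemma FOL_copies (V : SmallType) (I : SmallType) (ti : I -> simtype) :
  inhabited I ->
  exists ui : I -> simtype,
    pairwise_disjoint (fun i => P_ V (ui i)) /\
    (forall i, isomorphic (FOL V (ti i)) (FOL V (ui i))) /\
    exists u : simtype, P_ V u = union (fun i => P_ V (ui i)).
Proof.
  intro I_inh; destruct (FOL_disjoint_copies V ti) as [ui [ui_disjoint copies]].
  exists ui; split; [|split; [exact copies|]].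
  - intros i j ij a [Pi Pj]; exact (ui_disjoint i j ij _ (conj (P_dom Pi) (P_dom Pj))).
  - destruct (@simtype_union I ui I_inh) as [u u_union].
    + intros i j r m n ui_r uj_r; destruct (classic (i = j)) as [<- | ij]; [congruence|].
      destruct (ui_disjoint i j ij r (conj (dom_Some ui_r) (dom_Some uj_r))).
    + exists u; now apply P_union.
Qed.

Lemma P_small (V : SmallType) (t : simtype) : small (P_ V t).
Proof.
  apply (small_subset (small_union
    (fun vs : list V => small_image (fun r => (r, vs)) (dom_small t)))).
  intros [r vs] Pa; exists vs, r; split; [exact (P_dom Pa) | reflexivity].
Qed.

Lemma P_nonempty (V : Type) (t : simtype) : inhabited V -> exists a, P_ V t a.
Proof.
  intros [v]; destruct (exists_arity t) as [r [n t_r]].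
  exists (r, repeat v n); unfold P_; simpl; now rewrite repeat_length.
Qed.

(** * The logic family *)

Section Family.

Variable V : SmallType.
Hypothesis infinite_V : ~ Finite V.

Let inhabited_V : inhabited V := infinite_inhabited infinite_V.

Lemma FOL_Sig_P_ (t : simtype) : FOL_Sig (P_ V t).
Proof. now exists t. Qed.

Lemma FOL_Sig_family (I : Type) (Pi : I -> fol_atom V -> Prop) :
  (forall i, FOL_Sig (Pi i)) -> exists ti, Pi = fun i => P_ V (ti i).
Proof.
  intro SPi; destruct (functional_choice SPi) as [ti ti_Pi].
  exists ti; now apply functional_extensionality.
Qed.

Lemma FOL_family_reduct (P Q : fol_atom V -> Prop) (SP : FOL_Sig P) (SQ : FOL_Sig Q)
    (PQ : subset P Q) :
  reduct PQ (FOL_family V P SP) (FOL_family V Q SQ).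
Proof.
  destruct SP as [t <-], SQ as [u <-].
  rewrite !FOL_family_P_ by exact inhabited_V; now apply FOL_reduct.
Qed.

(** The union is an arbitrary [Q] here, so that [SQ] can be replaced by an
    equality with some [P_ V t]. *)
Lemma FOL_family_union (I : Type) (Pi : I -> fol_atom V -> Prop)
    (SPi : forall i, FOL_Sig (Pi i)) (Q : fol_atom V -> Prop) (SQ : FOL_Sig Q)
    (sub : forall i, subset (Pi i) Q) (phi psi : formula_algebra (fol_connectives V) Q)
    (A : algebra (fol_connectives V)) (h : formula_algebra (fol_connectives V) Q -> A) :
  subset Q (union Pi) -> Alg_m (FOL_family V Q SQ) A -> is_hom h ->
  (forall i x y, taut_congr (FOL_family V (Pi i) (SPi i)) x y ->
     h (formula_incl (sub i) x) = h (formula_incl (sub i) y)) ->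
  taut_congr (FOL_family V Q SQ) phi psi -> h phi = h psi.
Proof.
  destruct (FOL_Sig_family SPi) as [ti ->], SQ as [t <-].
  rewrite FOL_family_P_ by exact inhabited_V.
  intros cover A_mng h_hom h_congr.
  apply (@FOL_union V t I ti sub cover phi psi A h infinite_V A_mng h_hom).
  intros i x y xy; apply h_congr; now rewrite FOL_family_P_.
Qed.

Lemma FOL_family_copy (P : fol_atom V -> Prop) (SP : FOL_Sig P) (H : fol_atom V -> Prop) :
  small H ->
  exists P' (SP' : FOL_Sig P'),
    disjoint P' H /\ isomorphic (FOL_family V P SP) (FOL_family V P' SP').
Proof.
  intro H_small; destruct SP as [t <-].
  destruct (@FOL_copy V t H H_small) as [u [disj iso]].
  exists (P_ V u), (FOL_Sig_P_ u); split; [exact disj | now rewrite !FOL_family_P_].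
Qed.

Lemma FOL_family_copies (I : SmallType) (Pi : I -> fol_atom V -> Prop)
    (SPi : forall i, FOL_Sig (Pi i)) :
  inhabited I ->
  exists (Pi' : I -> fol_atom V -> Prop) (SPi' : forall i, FOL_Sig (Pi' i)),
    pairwise_disjoint Pi' /\
    (forall i, isomorphic (FOL_family V (Pi i) (SPi i)) (FOL_family V (Pi' i) (SPi' i))) /\
    FOL_Sig (union Pi').
Proof.
  intro I_inh; destruct (FOL_Sig_family SPi) as [ti ->].
  destruct (@FOL_copies V I ti I_inh) as [ui [disj [iso union_Sig]]].
  exists (fun i => P_ V (ui i)), (fun i => FOL_Sig_P_ (ui i)).
  split; [exact disj | split; [|exact union_Sig]].
  intro i; now rewrite !FOL_family_P_.
Qed.

End Family.

Theorem theorem5p3 (V : SmallType) (infinite_V : ~ Finite V) :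
  logic_family (FOL_family V).
Proof.
  constructor.
  - intros P [t <-]; apply P_small.
  - now apply FOL_family_reduct.
  - intros I Pi SPi SP _ phi psi; split.
    + intros phi_psi A h A_mng h_hom h_congr.
      refine (FOL_family_union infinite_V _ A_mng h_hom h_congr phi_psi); now intros a.
    + apply taut_congr_of_homs; intro i; now apply FOL_family_reduct.
  - now apply FOL_family_copy.
  - now apply FOL_family_copies.
  - destruct simtype_inhabited as [t].
    exists (P_ V t); split; [apply FOL_Sig_P_ | now apply P_nonempty, infinite_inhabited].
Qed.
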